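(* Let $\mathfrak{h}$ be a complex vector space and let $w,\chi:\mathfrak{h}^4\to\mathbb{C}$ be such that for all $p_1,p_2,p_3\in\mathfrak{h}$ the sets $\mathrm{Adm}(p_1,p_2,p_3;w)$ and $\mathrm{Adm}(p_1,p_2,p_3;\chi)$ are finite, and such that $w$ satisfies the Yang-Baxter equation $$\sum_{c\in\mathfrak{h}}w(a,b,c,d)\,w(b,e,f,c)\,w(c,f,g,d)=\sum_{c\in\mathfrak{h}}w(b,e,c,a)\,w(a,c,g,d)\,w(c,e,f,g)\qquad\text{for all }a,b,d,e,f,g\in\mathfrak{h}.$$ Fix $a,b,d,e,f,g\in\mathfrak{h}$ (heights on the outer boundary of three adjacent plaquettes) and $v,x,y,z\in\mathfrak{h}$ (heights of the shaded plaquettes $(e,v,x,f)$, $(f,x,y,g)$, $(g,y,z,d)$ attached to that boundary). Let the shaded triples be assigned consistently as follows: - the plaquettes $P,Q,R$, with heights $(a,b,c,d)$, $(b,e,f,c)$, $(c,f,g,d)$, are assigned the shaded triples $(f',g',z)$, $(v,x,g')$, $(x,y,z)$ respectively, where $\mathrm{Adm}_1(x,y,z)=\{g'\}$ and $\mathrm{Adm}_1(v,x,g')=\{f'\}$; - the plaquettes $P',Q',R'$, with heights $(c,e,f,g)$, $(a,c,g,d)$, $(b,e,c,a)$, are assigned the shaded triples $(v,x,y)$, $(f'',y,z)$, $(v,f'',g'')$ respectively, where $\mathrm{Adm}_1(v,x,y)=\{f''\}$ and $\mathrm{Adm}_1(f'',y,z)=\{g''\}$. Assume that each of these six shaded triples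 satisfies the conditions (i), (ii), (iii) of the context for its plaquette, for every value $c\in\mathfrak{h}$ of the interior height for which the quadruple of heights of the plaquette is admissible. Then the stochasticized weights satisfy $$\sum_{c\in\mathfrak{h}}S_P(a,b,c,d)\,S_Q(b,e,f,c)\,S_R(c,f,g,d)=\sum_{c\in\mathfrak{h}}S_{P'}(c,e,f,g)\,S_{Q'}(a,c,g,d)\,S_{R'}(b,e,c,a).$$
   Context: A quadruple in $\mathfrak{h}^4$ is admissible if $w$ is nonzero on it. For $p_1,p_2,p_3\in\mathfrak{h}$ and $u\in\{w,\chi\}$: $\mathrm{Adm}_1(p_1,p_2,p_3;u)=\{p\in\mathfrak{h}:u(p,p_1,p_2,p_3)\ne0\}$, $\mathrm{Adm}_3(p_1,p_2,p_3;u)=\{p\in\mathfrak{h}:u(p_1,p_2,p,p_3)\ne0\}$, and $\mathrm{Adm}=\mathrm{Adm}_1\cup\mathrm{Adm}_3$; $\mathrm{Adm}_1(\cdot)$ without further argument refers to $w$. A triple $(x,y,z)\in\mathfrak{h}^3$ is frozen if $|\mathrm{Adm}_1(x,y,z;w)|=1$. A plaquette with heights $(p_1,p_2,p_3,p_4)\in\mathfrak{h}^4$ at its four (counterclockwise) vertices is assigned a shaded triple $(x,y,z)\in\mathfrak{h}^3$, required to satisfy: (i) $(x,y,z)$ is frozen; write $\mathrm{Adm}_1(x,y,z;w)=\{p'\}$; (ii) $\chi(p_2,x,p',p_1)\neq0$ and $\chi(p_1,p',z,p_4)\ne0$; (iii) $\sum_{p\in\mathfrak{h}}w(p_1,p_2,p,p_4)\,\chi(p_2,x,y,p)\,\chi(p,y,z,p_4)=\chi(p_2,x,p',p_1)\,\chi(p_1,p',z,p_4)\,w(p',x,y,z)$.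 The stochasticization of $w$ with respect to $\chi$ at a plaquette $P$ with heights $(p_1,p_2,p_3,p_4)$ and shaded triple $(x,y,z)$ is $$S_P(p_1,p_2,p_3,p_4)=\frac{w(p_1,p_2,p_3,p_4)\,\chi(p_2,x,y,p_3)\,\chi(p_3,y,z,p_4)}{\chi(p_2,x,p',p_1)\,\chi(p_1,p',z,p_4)\,w(p',x,y,z)},$$ (understood as $0$ if $w(p_1,p_2,p_3,p_4)=0$). The form of the six shaded triples in the claim expresses the consistency condition: whenever two plaquettes share an edge, the shaded plaquette attached to the first in the positive direction along that edge (one of $(p_2,x,y,p_3)$, $(p_3,y,z,p_4)$) coincides with the shaded plaquette attached to the second in the negative direction along that edge (one of $(p_2,x,p',p_1)$, $(p_1,p',z,p_4)$). *)

(* Defs.v *)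
From HB Require Import structures.
From mathcomp Require Import all_boot all_order all_algebra.
From mathcomp Require Import boolp classical_sets functions cardinality fsbigop.
From mathcomp Require Import reals complex.

Set Implicit Arguments.
Unset Strict Implicit.
Unset Printing Implicit Defensive.

Import Order.TTheory GRing.Theory Num.Theory.
Local Open Scope classical_set_scope.
Local Open Scope ring_scope.
Local Open Scope complex_scope.

Definition Adm1 (R : realType) (h : lmodType R[i]) (u : h -> h -> h -> h -> R[i])
    (p1 p2 p3 : h) : set h :=
  [set p | u p p1 p2 p3 != 0].

Definition Adm3 (R : realType) (h : lmodType R[i]) (u : h -> h -> h -> h -> R[i])
    (p1 p2 p3 : h) : set h :=
  [set p | u p1 p2 p p3 != 0].

Definition Adm (R : realType) (h : lmodType R[i]) (u : h -> h -> h -> h -> R[i])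
    (p1 p2 p3 : h) : set h :=
  Adm1 u p1 p2 p3 `|` Adm3 u p1 p2 p3.

Definition admissible (R : realType) (h : lmodType R[i])
    (w : h -> h -> h -> h -> R[i]) (p1 p2 p3 p4 : h) : bool :=
  w p1 p2 p3 p4 != 0.

Definition frozen (R : realType) (h : lmodType R[i])
    (w : h -> h -> h -> h -> R[i]) (x y z : h) : Prop :=
  (Adm1 w x y z #= `I_1)%card.

(* The height p' with Adm1 w x y z = [set p']; only meaningful when (x, y, z)
   is frozen, and equal to the junk value chosen by xget otherwise. *)
Definition frozen_height (R : realType) (h : lmodType R[i])
    (w : h -> h -> h -> h -> R[i]) (x y z : h) : h :=
  xget 0 (Adm1 w x y z).

(* A sum \sum_(p \in [set: h]) F p is the finite sum over the support of F, with
   the default value 0 when that support is infinite. The support is finite in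
   every sum below as soon as all the sets Adm w p1 p2 p3 are. *)
Definition yang_baxter (R : realType) (h : lmodType R[i])
    (w : h -> h -> h -> h -> R[i]) : Prop :=
  forall a b d e f g : h,
    \sum_(c \in [set: h]) (w a b c d * w b e f c * w c f g d) =
    \sum_(c \in [set: h]) (w b e c a * w a c g d * w c e f g).

(* p3 does not occur in the body: the last condition sums over the third height. *)
Definition shaded_triple (R : realType) (h : lmodType R[i])
    (w chi : h -> h -> h -> h -> R[i]) (p1 p2 p3 p4 x y z : h) : Prop :=
  let p' := frozen_height w x y z in
  [/\ frozen w x y z,
      chi p2 x p' p1 != 0 /\ chi p1 p' z p4 != 0 &
      \sum_(p \in [set: h]) (w p1 p2 p p4 * chi p2 x y p * chi p y z p4) =
      chi p2 x p' p1 * chi p1 p' z p4 * w p' x y z].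

(* No case distinction is needed for w p1 p2 p3 p4 = 0: the numerator, hence
   the quotient, is then 0 whatever the denominator. *)
Definition stochasticization (R : realType) (h : lmodType R[i])
    (w chi : h -> h -> h -> h -> R[i]) (x y z p1 p2 p3 p4 : h) : R[i] :=
  let p' := frozen_height w x y z in
  (w p1 p2 p3 p4 * chi p2 x y p3 * chi p3 y z p4) /
  (chi p2 x p' p1 * chi p1 p' z p4 * w p' x y z).

(* Main.v *)
(* In the product of the three stochasticized weights on either side, the factors
   chi on interior edges cancel by consistency, so each side is its Yang-Baxter sum
   for w times a constant independent of c. If that sum is nonzero, all six triples
   are frozen, and the Yang-Baxter equation on the shaded boundary has a single
   nonzero term on each side. It identifies the frozen heights of (f', g', z) and
   (v, f'', g'') with g'' and f', and equates the products of the shaded weights,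
   so the two constants agree. *)

Require Import Defs.
From HB Require Import structures.
From mathcomp Require Import all_boot all_order all_algebra.
From mathcomp Require Import boolp classical_sets functions cardinality fsbigop.
From mathcomp Require Import reals complex.
From mathcomp Require Import ring.

Set Implicit Arguments.
Unset Strict Implicit.
Unset Printing Implicit Defensive.

Import Order.TTheory GRing.Theory Num.Theory.
Local Open Scope classical_set_scope.
Local Open Scope ring_scope.
Local Open Scope complex_scope.

Lemma fsbig_neq0 (V : nmodType) (T : choiceType) (D : set T) (F : T -> V) :
  \sum_(i \in D) F i != 0 -> exists2 i, D i & F i != 0.
Proof.
move=> sumF; apply: contrapT => noF; move/eqP: sumF; apply; apply: fsbig1 => i Di.
by apply: contrapT => /eqP Fi; apply: noF; exists i.
Qed.

Lemma fsbig_setT1 (V : nmodType) (T : choiceType) (i0 : T) (F : T -> V) :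
  (forall i, F i != 0 -> i = i0) -> \sum_(i \in [set: T]) F i = F i0.
Proof.
move=> F0; rewrite -(fsbig_widen [set i0]) ?fsbig_set1// => i [_] /= nei.
by apply: contrapT => /eqP/F0.
Qed.

Section FrozenTriples.
Variables (R : realType) (h : lmodType R[i]) (w : h -> h -> h -> h -> R[i]).

Lemma Adm1_set1P (x y z p : h) :
  Adm1 w x y z = [set p] -> forall q, w q x y z != 0 <-> q = p.
Proof. by move=> Ep q; have -> : (q = p) = Adm1 w x y z q by rewrite Ep. Qed.

Lemma frozen_height_set1 (x y z p : h) :
  Adm1 w x y z = [set p] -> frozen_height w x y z = p.
Proof. by move=> Ep; apply: xget_unique; rewrite Ep. Qed.

Lemma frozen_set1 (x y z : h) :
  frozen w x y z -> Adm1 w x y z = [set frozen_height w x y z].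
Proof.
case/eq_cardSP=> p wp; rewrite II0 card_eq0 => /eqP; rewrite setD_eq0 => sub_p.
have Ep : Adm1 w x y z = [set p] by apply/seteqP; split=> // q ->.
by rewrite (frozen_height_set1 Ep).
Qed.

(* The Yang-Baxter equation with outer boundary (p, q, v, x, y, z): freezing
   leaves a single interior height on each side. *)
Lemma frozen_yang_baxter (v x y z p q g' f'' : h) :
    yang_baxter w -> Adm1 w x y z = [set g'] -> Adm1 w v x y = [set f''] ->
  w p q g' z * w q v x g' * w g' x y z = w q v f'' p * w p f'' y z * w f'' v x y.
Proof.
move=> w_YB /Adm1_set1P Eg' /Adm1_set1P Ef''.
have := w_YB p q z v x y; rewrite (fsbig_setT1 (i0 := g')) => [->|c].
  rewrite (fsbig_setT1 (i0 := f''))// => c.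
  by rewrite mulf_eq0 negb_or => /andP[_ /Ef''].
by rewrite mulf_eq0 negb_or => /andP[_ /Eg'].
Qed.

(** Take the shaded boundary [(p, f', v, x, y, z)] in [frozen_yang_baxter]. Its left term is nonzero
    by the choice of [g'], [f'] and [p], so every factor on the right is nonzero: [w p f'' y z]
    forces [p = g''], and then [w f' v f'' g''] forces [f' = q]. *)
Lemma frozen_weights_eq (v x y z g' f' f'' g'' p q : h) :
    yang_baxter w ->
    Adm1 w x y z = [set g'] -> Adm1 w v x g' = [set f'] ->
    Adm1 w v x y = [set f''] -> Adm1 w f'' y z = [set g''] ->
    Adm1 w f' g' z = [set p] -> Adm1 w v f'' g'' = [set q] ->
  [/\ p = g'', q = f' &
      w p f' g' z * w f' v x g' * w g' x y z =
      w q v f'' g'' * w g'' f'' y z * w f'' v x y].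
Proof.
move=> w_YB Eg' Ef' Ef'' Eg'' Ep Eq.
have YB := frozen_yang_baxter p f' w_YB Eg' Ef''.
have : w f' v f'' p * w p f'' y z * w f'' v x y != 0.
  by rewrite -YB !mulf_neq0// ?(Adm1_set1P Ep) ?(Adm1_set1P Ef') ?(Adm1_set1P Eg').
rewrite !mulf_eq0 !negb_or => /andP[/andP[wq /(Adm1_set1P Eg'') pE] _].
by rewrite pE in wq YB *; move/(Adm1_set1P Eq): wq => <-.
Qed.

End FrozenTriples.

Theorem theorem3p11 (R : realType) (h : lmodType R[i])
  (w chi : h -> h -> h -> h -> R[i])
  (w_fin : forall p1 p2 p3 : h, finite_set (Adm w p1 p2 p3))
  (chi_fin : forall p1 p2 p3 : h, finite_set (Adm chi p1 p2 p3))
  (w_YB : yang_baxter w)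
  (a b d e f g v x y z f' g' f'' g'' : h)
  (Adm_g' : Adm1 w x y z = [set g'])
  (Adm_f' : Adm1 w v x g' = [set f'])
  (Adm_f'' : Adm1 w v x y = [set f''])
  (Adm_g'' : Adm1 w f'' y z = [set g''])
  (HP : forall c, admissible w a b c d -> shaded_triple w chi a b c d f' g' z)
  (HQ : forall c, admissible w b e f c -> shaded_triple w chi b e f c v x g')
  (HR : forall c, admissible w c f g d -> shaded_triple w chi c f g d x y z)
  (HP' : forall c, admissible w c e f g -> shaded_triple w chi c e f g v x y)
  (HQ' : forall c, admissible w a c g d -> shaded_triple w chi a c g d f'' y z)
  (HR' : forall c, admissible w b e c a -> shaded_triple w chi b e c a v f'' g'') :
  \sum_(c \in [set: h])
     (stochasticization w chi f' g' z a b c d *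
      stochasticization w chi v x g' b e f c *
      stochasticization w chi x y z c f g d) =
  \sum_(c \in [set: h])
     (stochasticization w chi v x y c e f g *
      stochasticization w chi f'' y z a c g d *
      stochasticization w chi v f'' g'' b e c a).
Proof.
pose W c := w a b c d * w b e f c * w c f g d.
pose W' c := w b e c a * w a c g d * w c e f g.
(* [p] and [q] may still be default values here; the factorizations [SW] and [SW'] hold
   regardless. *)
pose p := frozen_height w f' g' z; pose q := frozen_height w v f'' g''.
pose outer := chi e v x f * chi f x y g * chi g y z d.
pose K := outer / (chi e v f' b * chi b f' p a * chi a p z d *
  (w p f' g' z * w f' v x g' * w g' x y z)).
pose K' := outer / (chi e v q b * chi b q g'' a * chi a g'' z d *
  (w q v f'' g'' * w g'' f'' y z * w f'' v x y)).
have hE := (frozen_height_set1 Adm_g', frozen_height_set1 Adm_f',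
  frozen_height_set1 Adm_f'', frozen_height_set1 Adm_g'').
(* The remaining denominators may vanish, so their inverses are generalized
   before calling [field]. *)
have SW c : stochasticization w chi f' g' z a b c d *
    stochasticization w chi v x g' b e f c *
    stochasticization w chi x y z c f g d = K * W c.
  rewrite /stochasticization !hE -/p /K /W.
  have [->|wQ] := eqVneq (w b e f c) 0; first by rewrite !(mul0r, mulr0).
  have [->|wR] := eqVneq (w c f g d) 0; first by rewrite !(mul0r, mulr0).
  (* The three [chi] factors on interior edges each occur once in a numerator and once in a
     denominator; condition (ii) for Q and R makes them nonzero, so they cancel. *)
  have [_ [_ +] _] := HQ _ wQ; have [_ [+ +] _] := HR _ wR; rewrite !hE => n1 n2 n3.
  rewrite /outer !invfM.
  move: (chi e v f' b)^-1 (chi b f' p a)^-1 (chi a p z d)^-1 => i1 i2 i3.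
  move: (w p f' g' z)^-1 (w f' v x g')^-1 (w g' x y z)^-1 => j1 j2 j3.
  by field; rewrite n1 n2 n3.
have SW' c : stochasticization w chi v x y c e f g *
    stochasticization w chi f'' y z a c g d *
    stochasticization w chi v f'' g'' b e c a = K' * W' c.
  rewrite /stochasticization !hE -/q /K' /W'.
  have [->|wP'] := eqVneq (w c e f g) 0; first by rewrite !(mul0r, mulr0).
  have [->|wQ'] := eqVneq (w a c g d) 0; first by rewrite !(mul0r, mulr0).
  (* Here the interior edges are covered by condition (ii) for P' and Q'. *)
  have [_ [+ +] _] := HP' _ wP'; have [_ [+ _] _] := HQ' _ wQ'.
  rewrite !hE => n1 n2 n3.
  rewrite /outer !invfM.
  move: (chi e v q b)^-1 (chi b q g'' a)^-1 (chi a g'' z d)^-1 => i1 i2 i3.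
  move: (w q v f'' g'')^-1 (w g'' f'' y z)^-1 (w f'' v x y)^-1 => j1 j2 j3.
  by field; rewrite n1 n2 n3.
under eq_fsbigr do rewrite SW; under [RHS]eq_fsbigr do rewrite SW'.
rewrite -(mulr_fsumr K _ W) -(mulr_fsumr K' _ W').
have W_YB : \sum_(c \in [set: h]) W c = \sum_(c \in [set: h]) W' c := w_YB _ _ _ _ _ _.
rewrite -W_YB; have [->|sumW] := eqVneq (\sum_(c \in [set: h]) W c) 0.
  by rewrite !mulr0.
(* Only now are the outermost triples (f', g', z) and (v, f'', g'') known to be
   frozen: their conditions are void unless some c is admissible. *)
have [c _] := fsbig_neq0 sumW.
rewrite !mulf_eq0 !negb_or => /andP[/andP[/HP[/frozen_set1 Ep _ _] _] _].
(* Nonvanishing passes to the other sum, whose admissible height [c'] may differ from [c]. *)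
rewrite W_YB in sumW *; have [c' _] := fsbig_neq0 sumW.
rewrite !mulf_eq0 !negb_or => /andP[/andP[/HR'[/frozen_set1 Eq _ _] _] _].
have [pE qE YB] := frozen_weights_eq w_YB Adm_g' Adm_f' Adm_f'' Adm_g'' Ep Eq.
by rewrite /K /K' YB /p /q pE qE.
Qed.
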